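(* Let $M^n=\overline M^p\times\widetilde M^{n-p}$ be a product manifold and let $\Pi$ be a $1$-form on $M$. Then $M$ is recurrent satisfying $\nabla R=\Pi\otimes R$ if and only if (at every point of $U_0$): (i) $\overline\nabla\,\overline R=\overline\Pi\otimes\overline R$ and $\widetilde\Pi\otimes\overline R=0$; (ii) $\overline\Pi\otimes\widetilde R=0$ and $\widetilde\nabla\widetilde R=\widetilde\Pi\otimes\widetilde R$.
   Context: For a semi-Riemannian metric $g$ with Levi-Civita connection $\nabla$, $R$ denotes the $(0,4)$ Riemann-Christoffel curvature tensor; $\nabla R=\Pi\otimes R$ means locally $R_{ijkl,m}=\Pi_mR_{ijkl}$, where $_{,m}$ is the covariant derivative. Product. $(\overline M,\overline g)$ and $(\widetilde M,\widetilde g)$ are semi-Riemannian manifolds of dimensions $p$ and $n-p$ ($1\le p<n$, $n\ge3$) and $M=\overline M\times\widetilde M$ carries the product metric $g=\overline g+\widetilde g$; $M$ is assumed non-flat. $\overline R,\overline\nabla$ (resp. $\widetilde R,\widetilde\nabla$) are the curvature tensor and connection of $\overline g$ (resp. $\widetilde g$), tensors being pulled back to $M$. For a $1$-form $\Pi$ on $M$, $\overline\Pi$ and $\widetilde\Pi$ denote its parts with components along $\overline M$ and $\widetilde M$ respectively (components are functions on $M$). Definition. $M$ is recurrent ($K_n$) with associated $1$-form $\Pi$ if $\nabla R=\Pi\otimes R$ holds on $U_0=\{x\in M:\nabla R\ne0\text{ at }x\}$. *)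

(* Defs.v *)
From HB Require Import structures.
From mathcomp Require Import all_boot all_order all_algebra.
From mathcomp Require Import mathcomp_extra boolp classical_sets functions.
From mathcomp Require Import cardinality reals topology normedtype derive.
Set Implicit Arguments.
Unset Strict Implicit.
Unset Printing Implicit Defensive.
Import Order.TTheory GRing.Theory Num.Theory.
Import numFieldNormedType.Exports.
Local Open Scope classical_set_scope.
Local Open Scope ring_scope.

Section Smooth.
Context {R : realType} {n : nat}.
Implicit Types (f : 'rV[R]_n -> R) (U : set 'rV[R]_n).

Definition partial (i : 'I_n) f : 'rV[R]_n -> R :=
  fun u => 'D_(delta_mx 0 i) f u.

Definition iter_partial (s : seq 'I_n) f : 'rV[R]_n -> R := foldr partial f s.

(* C^oo on an open set U *)
Definition smooth_on U f : Prop :=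
  forall (s : seq 'I_n) u, U u ->
    {for u, continuous (iter_partial s f)} /\
    forall i, derivable (iter_partial s f) u (delta_mx 0 i).

End Smooth.

(* A smooth n-manifold without boundary, given by an atlas. [chart_inv c] is
   the local parametrization inverse to [chart c]; only its values on the open
   set [chart c @` chart_dom c] are meaningful. *)
Record manifold (R : realType) (n : nat) := Manifold {
  carrier :> topologicalType;
  chart_index : Type;
  chart_dom : chart_index -> set carrier;
  chart : chart_index -> carrier -> 'rV[R]_n;
  chart_inv : chart_index -> 'rV[R]_n -> carrier;
  manifold_hausdorff : hausdorff_space carrier;
  manifold_second_countable : @second_countable carrier;
  chart_cover : forall x, exists c, chart_dom c x;
  chart_dom_open : forall c, open (chart_dom c);
  chart_img_open : forall c, open (chart c @` chart_dom c);
  chartK : forall c x, chart_dom c x -> chart_inv c (chart c x) = x;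
  chart_continuous : forall c x, chart_dom c x -> {for x, continuous (chart c)};
  chart_inv_continuous : forall c u, (chart c @` chart_dom c) u ->
    {for u, continuous (chart_inv c)};
  transition_smooth : forall c d (k : 'I_n),
    smooth_on (chart c @` (chart_dom c `&` chart_dom d))
              (fun u => chart d (chart_inv c u) 0 k)
}.
Arguments chart_dom {R n m} : rename.
Arguments chart {R n m} : rename.
Arguments chart_inv {R n m} : rename.

Section Fields.
Context {R : realType} {n : nat} (M : manifold R n).
Implicit Types c d : chart_index M.

Definition chart_img c : set 'rV[R]_n := chart c @` chart_dom c.

(* the domain of the change of coordinates from [c] to [d] *)
Definition overlap c d : set 'rV[R]_n :=
  chart c @` (chart_dom c `&` chart_dom d).

Definition transition c d : 'rV[R]_n -> 'rV[R]_n :=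
  fun u => chart d (chart_inv c u).

(* entry (a, b) is the partial derivative of the b-th new coordinate with
   respect to the a-th old one *)
Definition transition_jac c d (u : 'rV[R]_n) : 'M[R]_n :=
  \matrix_(a, b) partial a (fun v => transition c d v 0 b) u.

Definition covector_field := chart_index M -> 'rV[R]_n -> 'rV[R]_n.

Record one_form := OneForm {
  form_coef :> covector_field;
  form_smooth : forall c (a : 'I_n),
    smooth_on (chart_img c) (fun u => form_coef c u 0 a);
  form_change : forall c d u, overlap c d u ->
    form_coef c u = form_coef d (transition c d u) *m (transition_jac c d u)^T
}.

End Fields.

(* Sylvester's normal form: the symmetric matrix A has exactly nu negative
   squares (and is nondegenerate) *)
Definition has_index (R : realType) n (A : 'M[R]_n) (nu : nat) : Prop :=
  exists P : 'M[R]_n, exists N : {set 'I_n},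
    [/\ P \in unitmx, #|N| = nu &
        P *m A *m P^T = diag_mx (\row_i (if i \in N then -1 else 1))].

Record semi_riemannian (R : realType) (n : nat) := SemiRiemannian {
  underlying :> manifold R n;
  metric : chart_index underlying -> 'rV[R]_n -> 'M[R]_n;
  metric_index : nat;
  metric_smooth : forall c (a b : 'I_n),
    smooth_on (chart_img c) (fun u => metric c u a b);
  metric_sym : forall c u, chart_img c u -> (metric c u)^T = metric c u;
  metric_nondegenerate : forall c u, chart_img c u -> metric c u \in unitmx;
  metric_has_index : forall c u, chart_img c u ->
    has_index (metric c u) metric_index;
  metric_change : forall c d u, overlap c d u ->
    metric c u = transition_jac c d u *m metric d (transition c d u)
                 *m (transition_jac c d u)^T
}.
Arguments metric {R n s} : rename.

Section LocalFormulas.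
Context {R : realType} {n : nat} (g : 'rV[R]_n -> 'M[R]_n).
Implicit Types (u : 'rV[R]_n) (i j k l m s t : 'I_n).

(* christoffel u k i j is Gamma^k_ij of the Levi-Civita connection of g *)
Definition christoffel u k i j : R :=
  2^-1 * \sum_l invmx (g u) k l *
    (partial i (fun v => g v j l) u + partial j (fun v => g v i l) u
     - partial l (fun v => g v i j) u).

(* R_ijkl = g(R(d_k, d_l) d_j, d_i) with R(X, Y) = [nabla_X, nabla_Y]
   - nabla_[X, Y] *)
Definition curvature u i j k l : R :=
  \sum_s g u i s *
    (partial k (fun v => christoffel v s l j) u
     - partial l (fun v => christoffel v s k j) u
     + \sum_t (christoffel u s k t * christoffel u t l j
               - christoffel u s l t * christoffel u t k j)).

(* the differentiation index comes first: nabla_curvature u m i j k l is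
   R_{ijkl,m} *)
Definition nabla_curvature u m i j k l : R :=
  partial m (fun v => curvature v i j k l) u
  - \sum_s (christoffel u s m i * curvature u s j k l
            + christoffel u s m j * curvature u i s k l
            + christoffel u s m k * curvature u i j s l
            + christoffel u s m l * curvature u i j k s).

End LocalFormulas.

(* components of a (0,k)-tensor, as a curried function of k indices *)
Fixpoint covtensor (R : realType) (n k : nat) : Type :=
  if k is k'.+1 then 'I_n -> covtensor R n k' else R.

Fixpoint tensor0 {R : realType} {n k : nat} : covtensor R n k :=
  match k return covtensor R n k with
  | 0 => 0
  | k'.+1 => fun=> tensor0
  end.

Fixpoint tensor_scale {R : realType} {n k : nat} (a : R) :
    covtensor R n k -> covtensor R n k :=
  match k return covtensor R n k -> covtensor R n k with
  | 0 => fun T => a * T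
  | k'.+1 => fun T i => tensor_scale a (T i)
  end.

Definition form_otimes {R : realType} {n k : nat} (w : 'rV[R]_n)
    (T : covtensor R n k) : covtensor R n k.+1 :=
  fun m => tensor_scale (w 0 m) T.

(* pullbacks along the projections of R^(p + q) onto its two factors: a
   component with an index of the other factor vanishes *)
Fixpoint pullback_l {R : realType} {p q k : nat} :
    covtensor R p k -> covtensor R (p + q) k :=
  match k return covtensor R p k -> covtensor R (p + q) k with
  | 0 => fun T => T
  | k'.+1 => fun T i =>
      match fintype.split i with inl a => pullback_l (T a) | inr _ => tensor0 end
  end.

Fixpoint pullback_r {R : realType} {p q k : nat} :
    covtensor R q k -> covtensor R (p + q) k :=
  match k return covtensor R q k -> covtensor R (p + q) k with
  | 0 => fun T => T
  | k'.+1 => fun T i =>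
      match fintype.split i with inl _ => tensor0 | inr b => pullback_r (T b) end
  end.

Definition form_part_l {R : realType} {p q : nat} (w : 'rV[R]_(p + q)) :
  'rV[R]_(p + q) := row_mx (lsubmx w) 0.
Definition form_part_r {R : realType} {p q : nat} (w : 'rV[R]_(p + q)) :
  'rV[R]_(p + q) := row_mx 0 (rsubmx w).

(* A tensor field is given by its components in every chart; two tensors are
   equal at x when their components agree in every chart around x. *)
Definition tensor_field {R : realType} {n : nat} (M : manifold R n) (k : nat) :=
  chart_index M -> 'rV[R]_n -> covtensor R n k.

Definition tensor_eq_at {R : realType} {n : nat} {M : manifold R n} {k : nat}
    (x : M) (S T : tensor_field M k) : Prop :=
  forall c, chart_dom c x -> S c (chart c x) = T c (chart c x).

Definition tensor_field0 {R : realType} {n : nat} {M : manifold R n} {k : nat}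
  : tensor_field M k := fun _ _ => tensor0.

Definition form_otimes_field {R : realType} {n : nat} {M : manifold R n} {k : nat}
    (w : covector_field M) (T : tensor_field M k) : tensor_field M k.+1 :=
  fun c u => form_otimes (w c u) (T c u).

Section Recurrence.
Context {R : realType} {n : nat} (M : semi_riemannian R n).

Definition curvature_field : tensor_field M 4 :=
  fun c => curvature (metric c).

Definition nabla_curvature_field : tensor_field M 5 :=
  fun c => nabla_curvature (metric c).

Definition flat : Prop :=
  forall x : M, tensor_eq_at x curvature_field tensor_field0.

Definition nonsymmetric_locus : set M :=
  [set x | ~ tensor_eq_at x nabla_curvature_field tensor_field0].

Definition recurrent (w : one_form M) : Prop :=
  forall x, nonsymmetric_locus x ->
    tensor_eq_at x nabla_curvature_field (form_otimes_field w curvature_field).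

End Recurrence.
Arguments curvature_field {R n} M.
Arguments nabla_curvature_field {R n} M.
Arguments nonsymmetric_locus {R n} M.

Section ProductFacts.
Context {R : realType}.

Lemma mx_continuous_at (T : topologicalType) m n (f : T -> 'M[R]_(m, n)) x :
  (forall i j, {for x, continuous (fun y => f y i j)}) ->
  {for x, continuous f}.
Proof.
move=> fc A [P Pf sPA]; rewrite /= !nbhs_simpl.
apply: (@filterS _ (nbhs x) _ [set y | forall i j, P i j (f y i j)]).
  by move=> y Py; exact: sPA.
apply: filter_forall => i; apply: filter_forall => j.
exact: (fc i j _ (Pf i j)).
Qed.

Lemma entry_continuous_at (T : topologicalType) m n (f : T -> 'M[R]_(m, n)) x
    i j :
  {for x, continuous f} -> {for x, continuous (fun y => f y i j)}.
Proof.
move=> fc.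
exact: (@continuous_comp _ _ _ f (fun A : 'M[R]_(m, n) => A i j) x fc
  (@coord_continuous _ _ _ i j (f x))).
Qed.

Lemma lsubmx_continuous p q : continuous (@lsubmx R 1 p q).
Proof.
move=> u; apply: mx_continuous_at => i j.
rewrite (_ : (fun y => _) = (fun y : 'rV[R]_(p + q) => y i (lshift q j))).
  exact: coord_continuous.
by apply/funext => y; rewrite mxE.
Qed.

Lemma rsubmx_continuous p q : continuous (@rsubmx R 1 p q).
Proof.
move=> u; apply: mx_continuous_at => i j.
rewrite (_ : (fun y => _) = (fun y : 'rV[R]_(p + q) => y i (rshift p j))).
  exact: coord_continuous.
by apply/funext => y; rewrite mxE.
Qed.

Lemma row_mx_continuous_at (T : topologicalType) p q
    (f : T -> 'rV[R]_p) (g : T -> 'rV[R]_q) x :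
  {for x, continuous f} -> {for x, continuous g} ->
  {for x, continuous (fun y => row_mx (f y) (g y))}.
Proof.
move=> fc gc; apply: mx_continuous_at => i j.
case: (fintype.splitP j) => k jk.
  have -> : j = lshift q k by apply/val_inj.
  under [X in {for _, continuous X}]funext do rewrite row_mxEl.
  exact: entry_continuous_at.
have -> : j = rshift p k by apply/val_inj.
under [X in {for _, continuous X}]funext do rewrite row_mxEr.
exact: entry_continuous_at.
Qed.

Section Precomp.
Context {n m : nat} (L : 'rV[R]_n -> 'rV[R]_m).
Hypothesis L_linear : forall (h : R) v u, L (h *: v + u) = h *: L v + L u.
Hypothesis Lc : continuous L.
Hypothesis L_basis : forall i : 'I_n,
  L (delta_mx 0 i) = 0 \/ exists k : 'I_m, L (delta_mx 0 i) = delta_mx 0 k.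

Lemma quotient_precomp (f : 'rV[R]_m -> R) u v :
  (fun h : R => h^-1 *: (((fun w => f (L w)) \o shift u) (h *: v) - f (L u))) =
  (fun h : R => h^-1 *: ((f \o shift (L u)) (h *: L v) - f (L u))).
Proof. by apply/funext => h /=; rewrite L_linear. Qed.

Lemma derive_precomp (f : 'rV[R]_m -> R) u v :
  'D_v (fun w => f (L w)) u = 'D_(L v) f (L u).
Proof.
by rewrite /derive quotient_precomp.
Qed.

Lemma derivable_precomp (f : 'rV[R]_m -> R) u v :
  derivable f (L u) (L v) -> derivable (fun w => f (L w)) u v.
Proof.
by rewrite /derivable quotient_precomp.
Qed.

Lemma iter_partial_cst0 l s : iter_partial s (fun _ : 'rV[R]_l => 0 : R) = fun=> 0.
Proof.
elim: s => //= i s ->; apply/funext => u.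
exact: (@derive_cst R 'rV[R]_l R).
Qed.

Lemma iter_partial_precomp (f : 'rV[R]_m -> R) s :
  iter_partial s (fun w => f (L w)) = (fun=> 0) \/
  exists s', iter_partial s (fun w => f (L w)) = fun w => iter_partial s' f (L w).
Proof.
elim: s => [|i s [IH|[s' IH]]] /=; first by right; exists [::].
- by left; rewrite IH; apply/funext => u; exact: (@derive_cst R 'rV[R]_n R).
- rewrite IH; case: (L_basis i) => [Li|[k Li]].
    by left; apply/funext => u; rewrite /partial derive_precomp Li derive0.
  right; exists (k :: s'); apply/funext => u.
  by rewrite /partial derive_precomp Li.
Qed.

Lemma smooth_precomp (f : 'rV[R]_m -> R) (U : set 'rV[R]_m) (V : set 'rV[R]_n) :
  smooth_on U f -> (forall u, V u -> U (L u)) -> smooth_on V (fun w => f (L w)).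
Proof.
move=> fs VU s u /VU Uu; case: (iter_partial_precomp f s) => [->|[s' ->]].
  by split=> [|i]; [exact: cst_continuous|exact: (@derivable_cst R 'rV[R]_n R)].
have [fc fd] := fs s' _ Uu; split.
  apply: (@continuous_comp _ _ _ L (iter_partial s' f)) => //; exact: Lc.
move=> i; apply: derivable_precomp; case: (L_basis i) => [->|[k ->]] //.
exact: derivable0.
Qed.

End Precomp.

Lemma smooth_cst0 n (U : set 'rV[R]_n) : smooth_on U (fun=> 0 : R).
Proof.
move=> s u _; rewrite iter_partial_cst0.
by split=> [|i]; [exact: cst_continuous|exact: (@derivable_cst R 'rV[R]_n R)].
Qed.

Section Split.
Context {p q : nat}.

Lemma lsubmx_delta_l (a : 'I_p) :
  lsubmx (delta_mx 0 (lshift q a)) = delta_mx 0 a :> 'rV[R]_p.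
Proof. by apply/rowP => b; rewrite !mxE eq_lshift. Qed.
Lemma lsubmx_delta_r (a : 'I_q) :
  lsubmx (delta_mx 0 (rshift p a)) = 0 :> 'rV[R]_p.
Proof. by apply/rowP => b; rewrite !mxE eq_lrshift andbF. Qed.
Lemma rsubmx_delta_l (a : 'I_p) :
  rsubmx (delta_mx 0 (lshift q a)) = 0 :> 'rV[R]_q.
Proof. by apply/rowP => b; rewrite !mxE eq_rlshift andbF. Qed.
Lemma rsubmx_delta_r (a : 'I_q) :
  rsubmx (delta_mx 0 (rshift p a)) = delta_mx 0 a :> 'rV[R]_q.
Proof. by apply/rowP => b; rewrite !mxE eq_rshift. Qed.

Lemma smooth_lsubmx (f : 'rV[R]_p -> R) U (V : set 'rV[R]_(p + q)) :
  smooth_on U f -> (forall u, V u -> U (lsubmx u)) ->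
  smooth_on V (fun w => f (lsubmx w)).
Proof.
apply: (@smooth_precomp _ _ (@lsubmx R 1 p q)).
    exact: linearP.
  exact: lsubmx_continuous.
move=> i; case: (fintype.splitP i) => k ik.
  have -> : i = lshift q k by apply/val_inj.
  by right; exists k; rewrite lsubmx_delta_l.
have -> : i = rshift p k by apply/val_inj.
by left; rewrite lsubmx_delta_r.
Qed.

Lemma smooth_rsubmx (f : 'rV[R]_q -> R) U (V : set 'rV[R]_(p + q)) :
  smooth_on U f -> (forall u, V u -> U (rsubmx u)) ->
  smooth_on V (fun w => f (rsubmx w)).
Proof.
apply: (@smooth_precomp _ _ (@rsubmx R 1 p q)).
    exact: linearP.
  exact: rsubmx_continuous.
move=> i; case: (fintype.splitP i) => k ik.
  have -> : i = lshift q k by apply/val_inj.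
  by left; rewrite rsubmx_delta_l.
have -> : i = rshift p k by apply/val_inj.
by right; exists k; rewrite rsubmx_delta_r.
Qed.

Lemma partial_lsubmx_l (f : 'rV[R]_p -> R) a (u : 'rV[R]_(p + q)) :
  partial (lshift q a) (fun w => f (lsubmx w)) u = partial a f (lsubmx u).
Proof.
by rewrite /partial (@derive_precomp _ _ (@lsubmx R 1 p q) (@linearP _ _ _ _ _)) lsubmx_delta_l.
Qed.
Lemma partial_lsubmx_r (f : 'rV[R]_p -> R) a (u : 'rV[R]_(p + q)) :
  partial (rshift p a) (fun w => f (lsubmx w)) u = 0.
Proof.
by rewrite /partial (@derive_precomp _ _ (@lsubmx R 1 p q) (@linearP _ _ _ _ _)) lsubmx_delta_r derive0.
Qed.
Lemma partial_rsubmx_l (f : 'rV[R]_q -> R) a (u : 'rV[R]_(p + q)) :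
  partial (lshift q a) (fun w => f (rsubmx w)) u = 0.
Proof.
by rewrite /partial (@derive_precomp _ _ (@rsubmx R 1 p q) (@linearP _ _ _ _ _)) rsubmx_delta_l derive0.
Qed.
Lemma partial_rsubmx_r (f : 'rV[R]_q -> R) a (u : 'rV[R]_(p + q)) :
  partial (rshift p a) (fun w => f (rsubmx w)) u = partial a f (rsubmx u).
Proof.
by rewrite /partial (@derive_precomp _ _ (@rsubmx R 1 p q) (@linearP _ _ _ _ _)) rsubmx_delta_r.
Qed.

Lemma has_index_block (A : 'M[R]_p) (B : 'M[R]_q) mu nu :
  has_index A mu -> has_index B nu ->
  has_index (block_mx A 0 0 B) (mu + nu).
Proof.
move=> [P [N [Pu <- PA]]] [Q [N' [Qu <- QB]]].
exists (block_mx P 0 0 Q).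
exists ((@lshift p q) @: N :|: (@rshift p q) @: N'); split.
- by rewrite unitmxE det_ublock unitrM -!unitmxE Pu.
- rewrite cardsU !card_imset; [|exact: rshift_inj|exact: lshift_inj].
  rewrite (_ : _ :&: _ = finset.set0) ?cards0 ?subn0 //.
  apply/finset.setP => i; rewrite finset.in_setI finset.in_set0.
  apply/negbTE/negP => /andP[/imsetP[a _ ->] /imsetP[b _]] /eqP.
  by rewrite eq_lrshift.
- rewrite tr_block_mx !trmx0 !mulmx_block !mulmx0 !mul0mx !addr0 !add0r !mul0mx PA QB.
  rewrite -diag_mx_row; congr diag_mx; apply/rowP => i.
  have lN a : (lshift q a \in (@lshift p q) @: N :|: (@rshift p q) @: N')
      = (a \in N).
    rewrite finset.in_setU mem_imset; last exact: lshift_inj.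
    rewrite orbC; case: imsetP => // -[b _] /eqP; by rewrite eq_lrshift.
  have rN a : (rshift p a \in (@lshift p q) @: N :|: (@rshift p q) @: N')
      = (a \in N').
    rewrite finset.in_setU orbC mem_imset; last exact: rshift_inj.
    rewrite orbC; case: imsetP => // -[b _] /eqP; by rewrite eq_rlshift.
  rewrite [RHS]mxE; case: (fintype.splitP i) => k ik.
    have -> : i = lshift q k by apply/val_inj.
    by rewrite row_mxEl mxE lN.
  have -> : i = rshift p k by apply/val_inj.
  by rewrite row_mxEr mxE rN.
Qed.

End Split.
End ProductFacts.

Section ProductManifold.
Context {R : realType} {p q : nat} (M1 : manifold R p) (M2 : manifold R q).

Local Notation carrier12 := (M1 * M2)%type.
Local Notation index12 := (chart_index M1 * chart_index M2)%type.
Implicit Types (c d : index12) (z : carrier12).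

Definition prod_chart_dom c : set carrier12 :=
  chart_dom c.1 `*` chart_dom c.2.

Definition prod_chart c z : 'rV[R]_(p + q) :=
  row_mx (chart c.1 z.1) (chart c.2 z.2).

Definition prod_chart_inv c (u : 'rV[R]_(p + q)) : carrier12 :=
  (chart_inv c.1 (lsubmx u), chart_inv c.2 (rsubmx u)).

Lemma prod_overlapE c (D1 : set M1) (D2 : set M2) :
  prod_chart c @` (D1 `*` D2) =
  [set u | (chart c.1 @` D1) (lsubmx u) /\ (chart c.2 @` D2) (rsubmx u)].
Proof.
apply/seteqP; split=> u /=.
  move=> [[x y] [/= D1x D2y] <-]; rewrite /prod_chart row_mxKl row_mxKr /=.
  by split; [exists x|exists y].
move=> [[x D1x xE] [y D2y yE]]; exists (x, y) => //.
by rewrite /prod_chart /= xE yE hsubmxK.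
Qed.

Lemma nbhsX (x : M1) (y : M2) (A : set M1) (B : set M2) :
  nbhs x A -> nbhs y B -> nbhs (x, y) (A `*` B).
Proof. by move=> xA yB; exists (A, B). Qed.

Lemma prod_hausdorff : hausdorff_space carrier12.
Proof.
move=> [x1 x2] [y1 y2] xy; congr (_, _).
- apply: (@manifold_hausdorff _ _ M1) => A B Ax By.
  have [[z1 z2] [[/= ? _] [/= ? _]]] :=
    xy _ _ (nbhsX Ax (@filterT _ (nbhs x2) _)) (nbhsX By (@filterT _ (nbhs y2) _)).
  by exists z1.
- apply: (@manifold_hausdorff _ _ M2) => A B Ax By.
  have [[z1 z2] [[/= _ ?] [/= _ ?]]] :=
    xy _ _ (nbhsX (@filterT _ (nbhs x1) _) Ax) (nbhsX (@filterT _ (nbhs y1) _) By).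
  by exists z2.
Qed.

Lemma openX (A : set M1) (B : set M2) : open A -> open B -> open (A `*` B).
Proof.
move=> oA oB; rewrite openE => -[x y] [/= Ax By].
by apply: nbhsX; apply: open_nbhs_nbhs.
Qed.

Lemma prod_second_countable : @second_countable carrier12.
Proof.
have [B1 cB1 [oB1 bB1]] := @manifold_second_countable _ _ M1.
have [B2 cB2 [oB2 bB2]] := @manifold_second_countable _ _ M2.
exists ((fun AB : set M1 * set M2 => AB.1 `*` AB.2) @` (B1 `*` B2)).
  by apply: (sub_countable (card_image_le _ _)); exact: countableX.
split.
  by move=> _ [[A B] [/= /oB1 oA /oB2 oB] <-]; exact: openX.
move=> [x y] W [[A B] [/= /bB1[A' [B1A' A'x] A'A] /bB2[B' [B2B' B'y] B'B]] sW].
exists (A' `*` B') => /=.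
  by split=> //; exists (A', B').
by move=> z [/A'A ? /B'B ?]; apply: sW.
Qed.

Lemma prod_chart_cover z : exists c, prod_chart_dom c z.
Proof.
have [c cz] := chart_cover z.1; have [d dz] := chart_cover z.2.
by exists (c, d).
Qed.

Lemma prod_chart_dom_open c : open (prod_chart_dom c).
Proof. by apply: openX; exact: chart_dom_open. Qed.

Lemma prod_chart_img_open c : open (prod_chart c @` prod_chart_dom c).
Proof.
rewrite prod_overlapE; apply: openI.
  apply: (@open_comp _ _ (@lsubmx R 1 p q)); last exact: chart_img_open.
  by move=> u _; exact: lsubmx_continuous.
apply: (@open_comp _ _ (@rsubmx R 1 p q)); last exact: chart_img_open.
by move=> u _; exact: rsubmx_continuous.
Qed.

Lemma prod_chartK c z :
  prod_chart_dom c z -> prod_chart_inv c (prod_chart c z) = z.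
Proof.
case: z => x y [/= cx cy].
by rewrite /prod_chart_inv /prod_chart row_mxKl row_mxKr !chartK.
Qed.

Lemma prod_chart_continuous c z :
  prod_chart_dom c z -> {for z, continuous (prod_chart c)}.
Proof.
case: z => x y [/= cx cy]; apply: row_mx_continuous_at.
  apply: (@continuous_comp _ _ _ fst (chart c.1)); first exact: cvg_fst.
  exact: chart_continuous.
apply: (@continuous_comp _ _ _ snd (chart c.2)); first exact: cvg_snd.
exact: chart_continuous.
Qed.

Lemma prod_chart_inv_continuous c u :
  (prod_chart c @` prod_chart_dom c) u -> {for u, continuous (prod_chart_inv c)}.
Proof.
rewrite prod_overlapE => -[cu1 cu2].
have h1 : {for u, continuous (fun v => chart_inv c.1 (lsubmx v))}.
  apply: (@continuous_comp _ _ _ (@lsubmx R 1 p q) (chart_inv c.1)).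
    exact: lsubmx_continuous.
  exact: chart_inv_continuous.
have h2 : {for u, continuous (fun v => chart_inv c.2 (rsubmx v))}.
  apply: (@continuous_comp _ _ _ (@rsubmx R 1 p q) (chart_inv c.2)).
    exact: rsubmx_continuous.
  exact: chart_inv_continuous.
exact: (cvg_pair h1 h2).
Qed.

Lemma prod_domI c d :
  prod_chart_dom c `&` prod_chart_dom d =
  (chart_dom c.1 `&` chart_dom d.1) `*` (chart_dom c.2 `&` chart_dom d.2).
Proof. by rewrite setXI. Qed.

Lemma prod_transition_smooth c d (k : 'I_(p + q)) :
  smooth_on (prod_chart c @` (prod_chart_dom c `&` prod_chart_dom d))
            (fun u => prod_chart d (prod_chart_inv c u) 0 k).
Proof.
rewrite prod_domI prod_overlapE; case: (fintype.splitP k) => l kl.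
  have -> : k = lshift q l by apply/val_inj.
  under [X in smooth_on _ X]funext do rewrite row_mxEl.
  apply: (smooth_lsubmx (transition_smooth (c := c.1) (d := d.1) l)).
  by move=> u [].
have -> : k = rshift p l by apply/val_inj.
under [X in smooth_on _ X]funext do rewrite row_mxEr.
apply: (smooth_rsubmx (transition_smooth (c := c.2) (d := d.2) l)).
by move=> u [].
Qed.

Definition prod_manifold : manifold R (p + q) :=
  @Manifold R (p + q) carrier12 index12 prod_chart_dom prod_chart prod_chart_inv
    prod_hausdorff prod_second_countable prod_chart_cover prod_chart_dom_open
    prod_chart_img_open prod_chartK prod_chart_continuous
    prod_chart_inv_continuous prod_transition_smooth.

Lemma prod_transition_jac c d (u : 'rV[R]_(p + q)) :
  @transition_jac R (p + q) prod_manifold c d u =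
  block_mx (transition_jac c.1 d.1 (lsubmx u)) 0
           0 (transition_jac c.2 d.2 (rsubmx u)).
Proof.
apply/matrixP => i j; rewrite mxE /transition /= /prod_chart /=.
case: (fintype.splitP j) => b jb.
  have -> : j = lshift q b by apply/val_inj.
  rewrite (_ : (fun v => _) =
    fun v => transition c.1 d.1 (lsubmx v) 0 b); last first.
    by apply/funext => v; rewrite row_mxEl.
  case: (fintype.splitP i) => a ia.
    have -> : i = lshift q a by apply/val_inj.
    by rewrite block_mxEul mxE (partial_lsubmx_l (fun v => transition _ _ v 0 b)).
  have -> : i = rshift p a by apply/val_inj.
  by rewrite block_mxEdl mxE (partial_lsubmx_r (fun v => transition _ _ v 0 b)).
have -> : j = rshift p b by apply/val_inj.
rewrite (_ : (fun v => _) =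
  fun v => transition c.2 d.2 (rsubmx v) 0 b); last first.
  by apply/funext => v; rewrite row_mxEr.
case: (fintype.splitP i) => a ia.
  have -> : i = lshift q a by apply/val_inj.
  by rewrite block_mxEur mxE (partial_rsubmx_l (fun v => transition _ _ v 0 b)).
have -> : i = rshift p a by apply/val_inj.
by rewrite block_mxEdr mxE (partial_rsubmx_r (fun v => transition _ _ v 0 b)).
Qed.

End ProductManifold.

Section ProductMetric.
Context {R : realType} {p q : nat}.
Context (M1 : semi_riemannian R p) (M2 : semi_riemannian R q).
Local Notation M12 := (prod_manifold M1 M2).
Implicit Types c d : chart_index M12.

Definition prod_metric c (u : 'rV[R]_(p + q)) : 'M[R]_(p + q) :=
  block_mx (metric c.1 (lsubmx u)) 0 0 (metric c.2 (rsubmx u)).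

Lemma prod_chart_imgE c u : chart_img c u ->
  chart_img c.1 (lsubmx u) /\ chart_img c.2 (rsubmx u).
Proof.
rewrite (_ : chart_img c =
  prod_chart c @` (chart_dom c.1 `*` chart_dom c.2)) //.
by rewrite prod_overlapE.
Qed.

Lemma prod_metric_smooth c (a b : 'I_(p + q)) :
  smooth_on (chart_img c) (fun u => prod_metric c u a b).
Proof.
case: (fintype.splitP a) => a' aa'; case: (fintype.splitP b) => b' bb'.
- have -> : a = lshift q a' by apply/val_inj.
  have -> : b = lshift q b' by apply/val_inj.
  rewrite (_ : (fun u => _) = fun u => metric c.1 (lsubmx u) a' b'); last first.
    by apply/funext => u; rewrite /prod_metric block_mxEul.
  apply: (smooth_lsubmx (metric_smooth (c := c.1) a' b')).
  by move=> u /prod_chart_imgE[].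
- have -> : a = lshift q a' by apply/val_inj.
  have -> : b = rshift p b' by apply/val_inj.
  rewrite (_ : (fun u => _) = fun=> 0); first exact: smooth_cst0.
  by apply/funext => u; rewrite /prod_metric block_mxEur mxE.
- have -> : a = rshift p a' by apply/val_inj.
  have -> : b = lshift q b' by apply/val_inj.
  rewrite (_ : (fun u => _) = fun=> 0); first exact: smooth_cst0.
  by apply/funext => u; rewrite /prod_metric block_mxEdl mxE.
- have -> : a = rshift p a' by apply/val_inj.
  have -> : b = rshift p b' by apply/val_inj.
  rewrite (_ : (fun u => _) = fun u => metric c.2 (rsubmx u) a' b'); last first.
    by apply/funext => u; rewrite /prod_metric block_mxEdr.
  apply: (smooth_rsubmx (metric_smooth (c := c.2) a' b')).
  by move=> u /prod_chart_imgE[].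
Qed.

Lemma prod_metric_sym c u :
  chart_img c u -> (prod_metric c u)^T = prod_metric c u.
Proof.
move=> /prod_chart_imgE[c1 c2].
by rewrite /prod_metric tr_block_mx !trmx0 !metric_sym.
Qed.

Lemma prod_metric_nondegenerate c u :
  chart_img c u -> prod_metric c u \in unitmx.
Proof.
move=> /prod_chart_imgE[c1 c2].
by rewrite unitmxE det_ublock unitrM -!unitmxE !metric_nondegenerate.
Qed.

Lemma prod_metric_has_index c u : chart_img c u ->
  has_index (prod_metric c u) (metric_index M1 + metric_index M2).
Proof.
by move=> /prod_chart_imgE[c1 c2]; apply: has_index_block; exact: metric_has_index.
Qed.

Lemma prod_metric_change c d u : overlap c d u ->
  prod_metric c u = transition_jac c d u *m prod_metric d (transition c d u)
                    *m (transition_jac c d u)^T.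
Proof.
rewrite (_ : overlap c d =
  prod_chart c @` (prod_chart_dom c `&` prod_chart_dom d)) //.
rewrite prod_domI prod_overlapE => -[u1 u2].
rewrite prod_transition_jac /prod_metric /transition /= /prod_chart.
rewrite row_mxKl row_mxKr tr_block_mx !trmx0 !mulmx_block.
rewrite !mulmx0 !mul0mx !addr0 !add0r !mul0mx.
by rewrite (metric_change u1) (metric_change u2).
Qed.

Definition prod_semi_riemannian : semi_riemannian R (p + q) :=
  @SemiRiemannian R (p + q) M12 prod_metric (metric_index M1 + metric_index M2)
    prod_metric_smooth prod_metric_sym prod_metric_nondegenerate
    prod_metric_has_index prod_metric_change.

(* tensor fields on the product, given in its product charts (c.1, c.2) *)
Definition pullback_field_l {k : nat} (T : tensor_field M1 k) :
    tensor_field prod_semi_riemannian k :=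
  fun c u => pullback_l (T c.1 (lsubmx u)).

Definition pullback_field_r {k : nat} (T : tensor_field M2 k) :
    tensor_field prod_semi_riemannian k :=
  fun c u => pullback_r (T c.2 (rsubmx u)).

Implicit Types w : one_form prod_semi_riemannian.

Definition form_part_l_field w : covector_field prod_semi_riemannian :=
  fun c u => form_part_l (form_coef w c u).

Definition form_part_r_field w : covector_field prod_semi_riemannian :=
  fun c u => form_part_r (form_coef w c u).

End ProductMetric.
Arguments pullback_field_l {R p q M1} M2 {k} T.
Arguments pullback_field_r {R p q} M1 {M2 k} T.

(* Main.v *)
(** In product charts the metric is block diagonal, each block depending only on
    the coordinates of its own factor. Hence the Christoffel symbols, R and
    nabla R have no mixed components: each is the sum of the pullbacks of the
    corresponding tensors of the factors. Splitting the indices of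
    nabla R = Pi (x) R according to the factors gives (i) when the curvature
    indices are all on the left, (ii) when they are all on the right, and 0 = 0
    otherwise; the derivative index selects the part of Pi involved. *)

Require Import Defs.
From mathcomp Require Import all_boot all_order all_algebra.
From mathcomp Require Import mathcomp_extra boolp classical_sets functions.
From mathcomp Require Import cardinality reals topology normedtype derive.
Set Implicit Arguments.
Unset Strict Implicit.
Unset Printing Implicit Defensive.
Import GRing.Theory.
Import numFieldNormedType.Exports.
Local Open Scope classical_set_scope.
Local Open Scope ring_scope.

(** * Tensors split along two factors and their coordinate derivatives *)

Section BlockTensor.
Context {R : realType} {p q : nat}.

Lemma split_lshift (a : 'I_p) : fintype.split (lshift q a) = inl a.
Proof. exact: (unsplitK (inl a)). Qed.

Lemma split_rshift (b : 'I_q) : fintype.split (rshift p b) = inr b.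
Proof. exact: (unsplitK (inr b)). Qed.

(* the sum of the two pullbacks, stated without addition so that its
   components reduce to those of one factor or to 0 *)
Definition block_tensor k (T1 : covtensor R p k.+1) (T2 : covtensor R q k.+1) :
    covtensor R (p + q) k.+1 :=
  fun i => match fintype.split i with
           | inl a => pullback_l (T1 a)
           | inr b => pullback_r (T2 b)
           end.

(** A derivative depends only on the germ of the function, so an identity known on an open set alone
    can still be differentiated there. *)
Lemma eq_partial_open {n} (U : set 'rV[R]_n) (f h : 'rV[R]_n -> R) (m : 'I_n) u :
  open U -> (forall v, U v -> f v = h v) -> U u -> partial m f u = partial m h u.
Proof.
move=> oU fh Uu; apply: near_eq_derive.
by apply: filterS fh _; exact: open_nbhs_nbhs.
Qed.

Lemma partial_cst0 {n} (m : 'I_n) u : partial m (fun _ : 'rV[R]_n => 0 : R) u = 0.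
Proof. exact: (@derive_cst R 'rV[R]_n R). Qed.

(** Coordinate derivative of every component at once, not a covariant derivative. The recursion on
    the rank lets one induction serve the metric, the Christoffel symbols and the curvature. *)
Fixpoint tensor_partial n k (m : 'I_n) :
    ('rV[R]_n -> covtensor R n k) -> 'rV[R]_n -> covtensor R n k :=
  match k return ('rV[R]_n -> covtensor R n k) -> 'rV[R]_n -> covtensor R n k with
  | 0 => partial m
  | k'.+1 => fun T u i => tensor_partial m (fun v => T v i) u
  end.

Lemma tensor_partial0 n k (m : 'I_n) u :
  tensor_partial m (fun=> @tensor0 R n k) u = tensor0.
Proof. by elim: k => [|k IH] /=; [exact: partial_cst0|apply/funext]. Qed.

(** By the chain rule: [lsubmx] maps the basis vectors of the left factor to basis vectors and kills
    those of the right factor. *)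
Lemma tensor_partial_pullback_l k (T : 'rV[R]_p -> covtensor R p k)
    (m : 'I_(p + q)) u :
  tensor_partial m (fun v => pullback_l (T (lsubmx v))) u =
  match fintype.split m with
  | inl a => pullback_l (tensor_partial a T (lsubmx u))
  | inr _ => tensor0
  end.
Proof.
case: (split_ordP m) => a ->; elim: k T => [|k IH] T /=;
  first [ exact: partial_lsubmx_l | exact: partial_lsubmx_r
        | apply/funext => i; case: (fintype.split i) => b;
            [exact: (IH (fun v => T v b)) | exact: tensor_partial0] ].
Qed.

Lemma tensor_partial_pullback_r k (T : 'rV[R]_q -> covtensor R q k)
    (m : 'I_(p + q)) u :
  tensor_partial m (fun v => pullback_r (T (rsubmx v))) u =
  match fintype.split m with
  | inl _ => tensor0
  | inr b => pullback_r (tensor_partial b T (rsubmx u))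
  end.
Proof.
case: (split_ordP m) => a ->; elim: k T => [|k IH] T /=;
  first [ exact: partial_rsubmx_l | exact: partial_rsubmx_r
        | apply/funext => i; case: (fintype.split i) => b;
            [exact: tensor_partial0 | exact: (IH (fun v => T v b))] ].
Qed.

Lemma tensor_partial_block k (T1 : 'rV[R]_p -> covtensor R p k.+1)
    (T2 : 'rV[R]_q -> covtensor R q k.+1) (m : 'I_(p + q)) u :
  tensor_partial m (fun v => block_tensor (T1 (lsubmx v)) (T2 (rsubmx v))) u =
  @block_tensor k.+1 (fun a => tensor_partial a T1 (lsubmx u))
                     (fun b => tensor_partial b T2 (rsubmx u)) m.
Proof.
(* Once the first tensor index [i] is fixed, the block tensor is a single pullback, and one of the
   two preceding lemmas applies. *)
apply/funext => i; rewrite /block_tensor /=.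
case: (split_ordP i) => c ->; rewrite ?split_lshift ?split_rshift.
  rewrite (tensor_partial_pullback_l (fun w => T1 w c)).
  by case: (fintype.split m) => a //=; rewrite split_lshift.
rewrite (tensor_partial_pullback_r (fun w => T2 w c)).
by case: (fintype.split m) => a //=; rewrite split_rshift.
Qed.

End BlockTensor.

Ltac split_index i :=
  let a := fresh "a" in case: (split_ordP i) => [a ->|a ->].

Ltac simpl_block :=
  rewrite /block_tensor /= ?split_lshift ?split_rshift /=
    ?split_lshift ?split_rshift /= ?split_lshift ?split_rshift /=
    ?split_lshift ?split_rshift /= ?split_lshift ?split_rshift /=.

Ltac simpl_zero :=
  rewrite ?(mulr0, mul0r, addr0, add0r, subr0, oppr0).

Lemma sum_split_l (R : realType) p q (F : 'I_(p + q) -> R) :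
  (forall b, F (rshift p b) = 0) -> \sum_s F s = \sum_a F (lshift q a).
Proof. by move=> F0; rewrite big_split_ord /= addrC big1 ?add0r. Qed.

Lemma sum_split_r (R : realType) p q (F : 'I_(p + q) -> R) :
  (forall a, F (lshift q a) = 0) -> \sum_s F s = \sum_b F (rshift p b).
Proof. by move=> F0; rewrite big_split_ord /= big1 ?add0r. Qed.

Lemma sum_split_0 (R : realType) p q (F : 'I_(p + q) -> R) :
  (forall a, F (lshift q a) = 0) -> (forall b, F (rshift p b) = 0) ->
  \sum_s F s = 0.
Proof. by move=> Fl Fr; rewrite sum_split_r ?big1. Qed.

(** For contractions: if the right side is 0, every term must vanish; otherwise the half of the
    index range that survives is found by trying left, then right. *)
Ltac split_sum tac :=
  let r := fresh "r" in
  lazymatch goal with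
  | |- _ = 0 => by (apply: sum_split_0 => r; tac)
  | _ => first
      [ rewrite sum_split_l => [|r]; [by (apply: eq_bigr => r _; tac) | by (tac)]
      | rewrite sum_split_r => [|r]; [by (apply: eq_bigr => r _; tac) | by (tac)]]
  end.

(** * Christoffel symbols, curvature and its derivative for a block diagonal metric *)

Section BlockMetric.
Context {R : realType} {p q : nat}.
Variables (g1 : 'rV[R]_p -> 'M[R]_p) (g2 : 'rV[R]_q -> 'M[R]_q).
(** [O] stands for the image of a product chart: invertibility of the metric is assumed only there,
    and openness allows identities on [O] to be differentiated. *)
Variable O : set 'rV[R]_(p + q).
Hypothesis open_O : open O.

Let g (u : 'rV[R]_(p + q)) := block_mx (g1 (lsubmx u)) 0 0 (g2 (rsubmx u)).

Hypothesis g_unit : forall u, O u -> g u \in unitmx.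

Lemma partial_block_metric m i j u :
  partial m (fun v => g v i j) u =
  @block_tensor _ _ _ 2 (fun m i j => partial m (fun w => g1 w i j) (lsubmx u))
                 (fun m i j => partial m (fun w => g2 w i j) (rsubmx u)) m i j.
Proof.
(* Matrices are read as rank 2 tensors through their coercion to functions. *)
rewrite (_ : (fun v => g v i j) = fun v =>
    @block_tensor _ _ _ 1 (g1 (lsubmx v)) (g2 (rsubmx v)) i j); last first.
  apply/funext => v; rewrite /g; split_index i; split_index j; simpl_block;
    by rewrite ?block_mxEul ?block_mxEur ?block_mxEdl ?block_mxEdr ?mxE.
exact: (f_equal (fun T : covtensor R (p + q) 2 => T i j)
  (tensor_partial_block (k := 1) (fun w => g1 w) (fun w => g2 w) m u)).
Qed.

(** The inverse metric is block diagonal too, so [l] runs only over the factor of [k]; the metric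
    derivatives with mixed indices vanish. *)
Lemma christoffel_block u k i j : O u ->
  christoffel g u k i j =
  @block_tensor _ _ _ 2 (christoffel g1 (lsubmx u)) (christoffel g2 (rsubmx u)) k i j.
Proof.
move=> Ou.
rewrite /christoffel (invmx_block_diag (g_unit Ou)).
under eq_bigr do rewrite !partial_block_metric.
split_index k; split_index i; split_index j; simpl_block;
  (* In the mixed cases the right side is 0; written as [2^-1 * 0], it lets the factor [2^-1] be
     stripped uniformly. *)
  rewrite -1?[RHS](mulr0 2^-1); congr (_ * _); split_sum
    ltac:(simpl_block; rewrite ?block_mxEul ?block_mxEur ?block_mxEdl ?block_mxEdr
            ?mxE; simpl_zero).
Qed.

Lemma partial_christoffel_block u m k i j : O u ->
  partial m (fun v => christoffel g v k i j) u =
  @block_tensor _ _ _ 3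
    (fun m k i j => partial m (fun w => christoffel g1 w k i j) (lsubmx u))
    (fun m k i j => partial m (fun w => christoffel g2 w k i j) (rsubmx u))
    m k i j.
Proof.
move=> Ou.
rewrite (eq_partial_open m open_O (fun v Ov => christoffel_block k i j Ov)) //.
exact: (f_equal (fun T : covtensor R (p + q) 3 => T k i j)
  (tensor_partial_block (k := 2) (christoffel g1) (christoffel g2) m u)).
Qed.

Lemma christoffel_quadratic_block u s j k l : O u ->
  let quadratic n (h : 'rV[R]_n -> 'M[R]_n) w (s j k l : 'I_n) :=
    \sum_t (christoffel h w s k t * christoffel h w t l j
            - christoffel h w s l t * christoffel h w t k j) in
  quadratic _ g u s j k l =
  @block_tensor _ _ _ 3 (quadratic _ g1 (lsubmx u)) (quadratic _ g2 (rsubmx u))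
    s j k l.
Proof.
move=> Ou quadratic; rewrite /quadratic.
under eq_bigr do rewrite !christoffel_block //.
(* From here only the block shape matters, so the symbols become arbitrary. *)
move: (christoffel g1 _) (christoffel g2 _) => C1 C2.
split_index s; split_index j; split_index k; split_index l; simpl_block;
  split_sum ltac:(simpl_block; simpl_zero).
Qed.

(** Lowering the index with a block diagonal metric keeps [s] in the factor of [i], and both parts
    of the bracket are already block tensors. *)
Lemma curvature_block u i j k l : O u ->
  curvature g u i j k l =
  @block_tensor _ _ _ 3 (curvature g1 (lsubmx u)) (curvature g2 (rsubmx u))
    i j k l.
Proof.
move=> Ou; rewrite /curvature.
under eq_bigr do
  rewrite !partial_christoffel_block // christoffel_quadratic_block // /g.
split_index i; split_index j; split_index k; split_index l; simpl_block;
  split_sum ltac:(simpl_block;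
    rewrite ?block_mxEul ?block_mxEur ?block_mxEdl ?block_mxEdr
            ?mxE; simpl_zero).
Qed.

Lemma partial_curvature_block u m i j k l : O u ->
  partial m (fun v => curvature g v i j k l) u =
  @block_tensor _ _ _ 4
    (fun m i j k l => partial m (fun w => curvature g1 w i j k l) (lsubmx u))
    (fun m i j k l => partial m (fun w => curvature g2 w i j k l) (rsubmx u))
    m i j k l.
Proof.
move=> Ou.
rewrite (eq_partial_open m open_O (fun v Ov => curvature_block i j k l Ov)) //.
exact: (f_equal (fun T : covtensor R (p + q) 4 => T i j k l)
  (tensor_partial_block (k := 3) (curvature g1) (curvature g2) m u)).
Qed.

(** In each product the summed index [s] occurs in both factors, so a nonzero term forces all the
    free indices into the block of [s]. *)
Lemma christoffel_curvature_block u m i j k l : O u ->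
  let contraction n (h : 'rV[R]_n -> 'M[R]_n) w (m i j k l : 'I_n) :=
    \sum_s (christoffel h w s m i * curvature h w s j k l
            + christoffel h w s m j * curvature h w i s k l
            + christoffel h w s m k * curvature h w i j s l
            + christoffel h w s m l * curvature h w i j k s) in
  contraction _ g u m i j k l =
  @block_tensor _ _ _ 4 (contraction _ g1 (lsubmx u))
    (contraction _ g2 (rsubmx u)) m i j k l.
Proof.
move=> Ou contraction; rewrite /contraction.
under eq_bigr do rewrite !christoffel_block // !curvature_block //.
move: (christoffel g1 _) (christoffel g2 _) => C1 C2.
move: (curvature g1 _) (curvature g2 _) => R1 R2.
split_index m; split_index i; split_index j; split_index k; split_index l;
  simpl_block; split_sum ltac:(simpl_block; simpl_zero).
Qed.

Lemma nabla_curvature_block u m i j k l : O u ->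
  nabla_curvature g u m i j k l =
  @block_tensor _ _ _ 4 (nabla_curvature g1 (lsubmx u))
    (nabla_curvature g2 (rsubmx u)) m i j k l.
Proof.
move=> Ou; rewrite /nabla_curvature partial_curvature_block //.
rewrite christoffel_curvature_block //.
split_index m; split_index i; split_index j; split_index k; split_index l;
  by simpl_block; simpl_zero.
Qed.

End BlockMetric.

(** * Splitting the recurrence equation between the two factors *)

Section BlockRecurrence.
Context {R : realType} {p q : nat}.

Lemma tensor_scale_0l n k (T : covtensor R n k) : tensor_scale 0 T = tensor0.
Proof. by elim: k T => [|k IH] T /=; [rewrite mul0r|apply/funext]. Qed.

Lemma tensor_scale_0r n k (a : R) : tensor_scale a (@tensor0 R n k) = tensor0.
Proof. by elim: k => [|k IH] /=; [rewrite mulr0|apply/funext]. Qed.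

Lemma form_part_lE (w : 'rV[R]_(p + q)) i :
  form_part_l w 0 i = if fintype.split i is inl _ then w 0 i else 0.
Proof.
rewrite /form_part_l; split_index i; rewrite ?split_lshift ?split_rshift.
  by rewrite row_mxEl mxE.
by rewrite row_mxEr mxE.
Qed.

Lemma form_part_rE (w : 'rV[R]_(p + q)) i :
  form_part_r w 0 i = if fintype.split i is inr _ then w 0 i else 0.
Proof.
rewrite /form_part_r; split_index i; rewrite ?split_lshift ?split_rshift.
  by rewrite row_mxEl mxE.
by rewrite row_mxEr mxE.
Qed.

(** Only the derivative index [m] and the first curvature index [i] need to be split: with [i]
    fixed, what remains is a pullback from one factor. The four positions of [m] and [i] correspond
    to the four equations. *)
Lemma block_recurrence k (w : 'rV[R]_(p + q))
    (N1 : covtensor R p k.+2) (N2 : covtensor R q k.+2)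
    (R1 : covtensor R p k.+1) (R2 : covtensor R q k.+1) :
  block_tensor N1 N2 = form_otimes w (block_tensor R1 R2) <->
  (pullback_l N1 = form_otimes (form_part_l w) (@pullback_l R p q _ R1) /\
   form_otimes (form_part_r w) (@pullback_l R p q _ R1) = tensor0) /\
  (form_otimes (form_part_l w) (@pullback_r R p q _ R2) = tensor0 /\
   pullback_r N2 = form_otimes (form_part_r w) (@pullback_r R p q _ R2)).
Proof.
split=> [e|[[N1E R1E] [R2E N2E]]].
  have {}e m i := f_equal (fun T : covtensor R (p + q) k.+2 => T m i) e.
  split; split; apply/funext => m; apply/funext => i;
    move: (e m i); rewrite /form_otimes ?form_part_lE ?form_part_rE;
    split_index m; split_index i; simpl_block;
    by rewrite ?tensor_scale_0l ?tensor_scale_0r.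
apply/funext => m; apply/funext => i.
(* All four equations are evaluated at the same [m] and [i]; in each case one of them is the goal
   and the others become trivial. *)
move: (f_equal (fun T : covtensor R (p + q) k.+2 => T m i) N1E).
move: (f_equal (fun T : covtensor R (p + q) k.+2 => T m i) R1E).
move: (f_equal (fun T : covtensor R (p + q) k.+2 => T m i) R2E).
move: (f_equal (fun T : covtensor R (p + q) k.+2 => T m i) N2E).
rewrite /form_otimes form_part_lE form_part_rE.
by split_index m; split_index i; simpl_block;
  rewrite ?tensor_scale_0l ?tensor_scale_0r.
Qed.

End BlockRecurrence.

Lemma chart_imgP (R : realType) n (M : manifold R n) (c : chart_index M) x :
  chart_dom c x -> chart_img c (chart c x).
Proof. by move=> cx; exists x. Qed.

(** * Transfer to the charts of the product manifold *)

Section ProductCurvature.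
Context {R : realType} {p q : nat}.
Variables (M1 : semi_riemannian R p) (M2 : semi_riemannian R q).
Local Notation M := (prod_semi_riemannian M1 M2).

(** The product metric in the chart [c] is by definition a block matrix, so the local result applies
    with the chart image as [O]. *)
Lemma prod_curvature_field (c : chart_index M) u : chart_img c u ->
  curvature_field M c u =
  block_tensor (curvature_field M1 c.1 (lsubmx u) : covtensor R p 4)
               (curvature_field M2 c.2 (rsubmx u) : covtensor R q 4).
Proof.
move=> cu; apply/funext => i; apply/funext => j; apply/funext => k.
apply/funext => l.
exact: (@curvature_block R p q (metric c.1) (metric c.2) (chart_img c)
  (@chart_img_open _ _ M c) (@prod_metric_nondegenerate _ _ _ M1 M2 c)).
Qed.

Lemma prod_nabla_curvature_field (c : chart_index M) u : chart_img c u ->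
  nabla_curvature_field M c u =
  block_tensor (nabla_curvature_field M1 c.1 (lsubmx u) : covtensor R p 5)
               (nabla_curvature_field M2 c.2 (rsubmx u) : covtensor R q 5).
Proof.
move=> cu; apply/funext => m; apply/funext => i; apply/funext => j.
apply/funext => k; apply/funext => l.
exact: (@nabla_curvature_block R p q (metric c.1) (metric c.2) (chart_img c)
  (@chart_img_open _ _ M c) (@prod_metric_nondegenerate _ _ _ M1 M2 c)).
Qed.

Lemma prod_recurrence_chart (Pi : one_form M) (c : chart_index M) u :
  chart_img c u ->
  nabla_curvature_field M c u =
    form_otimes_field Pi (curvature_field M) c u <->
  (pullback_field_l M2 (nabla_curvature_field M1) c u =
     form_otimes_field (form_part_l_field Pi)
       (pullback_field_l M2 (curvature_field M1)) c u /\
   form_otimes_field (form_part_r_field Pi)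
     (pullback_field_l M2 (curvature_field M1)) c u = tensor0) /\
  (form_otimes_field (form_part_l_field Pi)
     (pullback_field_r M1 (curvature_field M2)) c u = tensor0 /\
   pullback_field_r M1 (nabla_curvature_field M2) c u =
     form_otimes_field (form_part_r_field Pi)
       (pullback_field_r M1 (curvature_field M2)) c u).
Proof.
move=> cu; rewrite prod_nabla_curvature_field // /form_otimes_field.
by rewrite prod_curvature_field //; exact: block_recurrence.
Qed.

End ProductCurvature.

Theorem corollary4p6 (R : realType) (n p : nat)
    (hp : (1 <= p)%N) (hpn : (p < n)%N) (hn : (3 <= n)%N)
    (M1 : semi_riemannian R p) (M2 : semi_riemannian R (n - p))
    (nonflat : ~ flat (prod_semi_riemannian M1 M2))
    (Pi : one_form (prod_semi_riemannian M1 M2)) :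
  recurrent Pi <->
  (forall z : prod_semi_riemannian M1 M2,
     nonsymmetric_locus (prod_semi_riemannian M1 M2) z ->
     (tensor_eq_at z
        (pullback_field_l M2 (nabla_curvature_field M1))
        (form_otimes_field (form_part_l_field Pi)
           (pullback_field_l M2 (curvature_field M1))) /\
      tensor_eq_at z
        (form_otimes_field (form_part_r_field Pi)
           (pullback_field_l M2 (curvature_field M1)))
        tensor_field0) /\
     (tensor_eq_at z
        (form_otimes_field (form_part_l_field Pi)
           (pullback_field_r M1 (curvature_field M2)))
        tensor_field0 /\
      tensor_eq_at z
        (pullback_field_r M1 (nabla_curvature_field M2))
        (form_otimes_field (form_part_r_field Pi)
           (pullback_field_r M1 (curvature_field M2))))).
Proof.
split=> [rec z Uz | conds z Uz c cz].
  (* Tensor equality at [z] ranges over all charts around [z]: a chart is fixed first, and the four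
     equations are read off in it. *)
  by split; split=> c cz;
    have /(prod_recurrence_chart Pi (chart_imgP cz))[[? ?] [? ?]] := rec z Uz c cz.
apply/(prod_recurrence_chart Pi (chart_imgP cz)).
by have [[h1 h2] [h3 h4]] := conds z Uz; split; split; [exact: h1|exact: h2|exact: h3|exact: h4].
Qed.
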